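(* Let $H$ be an infinite dimensional complex Hilbert space. The C$^*$-algebra $K(H)$ of all compact operators on $H$, regarded as a Jordan Banach triple with respect to $\{a,b,c\}=\frac12(ab^*c+cb^*a)$, is not ternary weakly amenable.
   Context: Let $E$ be a complex Jordan Banach triple (here, a C$^*$-algebra with $\{a,b,c\}=\frac12(ab^*c+cb^*a)$). The dual $E^*$ is a Jordan triple $E$-module with the products $\{a,b,\varphi\}(x)=\{\varphi,b,a\}(x):=\varphi(\{b,a,x\})$ and $\{a,\varphi,b\}(x):=\overline{\varphi(\{a,x,b\})}$ for $a,b,x\in E$, $\varphi\in E^*$. A ternary derivation $\delta:E\to E^*$ is a conjugate linear map with $\delta\{a,b,c\}=\{\delta(a),b,c\}+\{a,\delta(b),c\}+\{a,b,\delta(c)\}$ for all $a,b,c\in E$. For $b\in E$, $\varphi\in E^*$, the map $\delta(b,\varphi):E\to E^*$, $\delta(b,\varphi)(a):=\{b,\varphi,a\}-\{\varphi,b,a\}$, is a ternary derivation; finite sums of such maps are called inner ternary derivations. $E$ is ternary weakly amenable if every continuous ternary derivation $E\to E^*$ is inner. *)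

(* Defs.v *)
From HB Require Import structures.
From mathcomp Require Import all_boot all_order all_algebra.
From mathcomp Require Import sesquilinear complex.
From mathcomp Require Import all_classical all_reals all_analysis ring.

Set Implicit Arguments.
Unset Strict Implicit.
Unset Printing Implicit Defensive.

Import Order.TTheory GRing.Theory Num.Theory.
Import numFieldNormedType.Exports.

Local Open Scope classical_set_scope.
Local Open Scope ring_scope.
Local Open Scope complex_scope.

Section BoundedOp.
Variables (R : realType) (V W : normedModType R[i]).

Definition bounded_op_pred : {pred V -> W} :=
  [pred f | `[< linear f >] && `[< continuous f >]].

Record bounded_op := BoundedOp {
  bounded_op_fun :> V -> W;
  bounded_opP : bounded_op_fun \in bounded_op_pred }.

HB.instance Definition _ := [isSub for bounded_op_fun].
HB.instance Definition _ := [Choice of bounded_op by <:].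

Lemma bounded_op_submod_closed : submod_closed bounded_op_pred.
Proof.
split=> [|k f g].
  rewrite inE; apply/andP; split; apply/asboolP.
    by move=> a x y; rewrite /= scaler0 addr0.
  exact: cst_continuous.
rewrite !inE => /andP[/asboolP lf /asboolP cf] /andP[/asboolP lg /asboolP cg].
apply/andP; split; apply/asboolP.
  move=> a x y; rewrite !fctE lf lg.
  by rewrite !scalerDr !scalerA (mulrC k) addrACA.
move=> x; apply: cvgD; last exact: cg.
by apply: cvgZl_tmp; apply: cf.
Qed.

HB.instance Definition _ :=
  GRing.isSubmodClosed.Build R[i] (V -> W) bounded_op_pred
    bounded_op_submod_closed.
HB.instance Definition _ := [SubChoice_isSubLmodule of bounded_op by <:].

Implicit Types f g : bounded_op.

Lemma bounded_op_linear f : linear f.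
Proof. by case: f => f /= /andP[/asboolP]. Qed.

HB.instance Definition _ f :=
  GRing.isLinear.Build R[i] V W *:%R (bounded_op_fun f) (bounded_op_linear f).

Lemma bounded_op_continuous f : continuous f.
Proof. by case: f => f /= /andP[_ /asboolP]. Qed.

Lemma mk_bounded_op (h : V -> W) : linear h -> continuous h ->
  h \in bounded_op_pred.
Proof. by move=> lh ch; rewrite inE; apply/andP; split; apply/asboolP. Qed.

Lemma bounded_op_ext f g : f =1 g -> f = g.
Proof. by move=> fg; apply/val_inj/funext. Qed.

Lemma bounded_op0E x : (0 : bounded_op) x = 0. Proof. by []. Qed.
Lemma bounded_opDE f g x : (f + g) x = f x + g x. Proof. by []. Qed.
Lemma bounded_opNE f x : (- f) x = - f x. Proof. by []. Qed.
Lemma bounded_opBE f g x : (f - g) x = f x - g x. Proof. by []. Qed.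
Lemma bounded_opZE k f x : (k *: f) x = k *: f x. Proof. by []. Qed.

(* The norms of V and W take their values in R[i]; they are nonnegative, hence
   equal to their real parts, and the supremum is taken in R. *)
Definition opnorm f : R[i] :=
  (sup [set complex.Re `|f x| | x in [set x | `|x| <= 1]])%:C.

Lemma bounded_op_bound f : exists2 M : R[i], 0 < M & forall x, `|f x| <= M * `|x|.
Proof.
have /linear_bounded_continuous/linear_boundedP : continuous (f : {linear V -> W}).
  exact: bounded_op_continuous.
by move=> /pinfty_ex_gt0[M M0 fM]; exists M.
Qed.

Lemma bounded_opP_bound (h : V -> W) (M : R[i]) : linear h ->
  (forall x, `|h x| <= M * `|x|) -> h \in bounded_op_pred.
Proof.
move=> lh hM; apply: mk_bounded_op => //.
pose L := GRing.isLinear.Build R[i] V W *:%R h lh.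
pose hl : {linear V -> W} := HB.pack h L.
apply: (@bounded_linear_continuous _ _ _ hl).
rewrite /bounded_near; exists (`|M|); split; first exact: normr_real.
move=> N MN; apply/nbhs_normP; exists 1 => //= x /=.
rewrite sub0r normrN => x1; apply: (le_trans (hM x)).
have [->|x0] := eqVneq x 0; first by rewrite normr0 mulr0 (le_trans _ (ltW MN)).
have M0 : 0 <= M.
  by rewrite -(pmulr_lge0 _ (_ : 0 < `|x|)) ?normr_gt0// (le_trans _ (hM x)).
apply: le_trans (ltW MN); rewrite (ger0_norm M0).
by rewrite ler_piMr// ltW.
Qed.

Let nC (z : R[i]) : 0 <= z -> (complex.Re z)%:C = z.
Proof. by move=> z0; rewrite RRe_real// ger0_real. Qed.

Let opset f := [set complex.Re `|f x| | x in [set x | `|x| <= 1]].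

Let opset0 f : opset f !=set0.
Proof. by exists (complex.Re `|f 0|); exists 0 => //=; rewrite normr0. Qed.

Let opset_ub f (M : R[i]) : 0 <= M -> (forall x, `|x| <= 1 -> `|f x| <= M) ->
  ubound (opset f) (complex.Re M).
Proof.
by move=> M0 fM _ [x x1 <-]; rewrite -lecR !nC//; exact: fM.
Qed.

Let opset_sup f : has_ubound (opset f).
Proof.
have [M M0 fM] := bounded_op_bound f.
exists (complex.Re M); apply: opset_ub; first exact: ltW.
by move=> x x1; apply: le_trans (fM x) _; rewrite ler_piMr// ltW.
Qed.

Lemma opnorm_ge0 f : 0 <= opnorm f.
Proof.
rewrite /opnorm ler0c; have [r [x x1 xr]] := opset0 f.
apply: (le_trans (_ : 0 <= r)).
  by rewrite -xr -ler0c nC.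
by apply: ub_le_sup; [exact: opset_sup | exists x].
Qed.

Lemma le_opnorm1 f x : `|x| <= 1 -> `|f x| <= opnorm f.
Proof.
move=> x1; rewrite -(nC (normr_ge0 (f x))) /opnorm lecR.
by apply: ub_le_sup; [exact: opset_sup | exists x].
Qed.

Lemma le_opnorm f x : `|f x| <= opnorm f * `|x|.
Proof.
have [->|x0] := eqVneq x 0; first by rewrite linear0 !normr0 mulr0.
have nx : 0 < `|x| by rewrite normr_gt0.
rewrite -ler_pdivrMr// mulrC -[X in X * _](ger0_norm (_ : 0 <= `|x|^-1)).
  rewrite -normrZ -linearZ/=; apply: le_opnorm1.
  by rewrite normrZ ger0_norm ?invr_ge0// mulVf// gt_eqF.
by rewrite invr_ge0.
Qed.

Lemma opnorm_le1 f (M : R[i]) : 0 <= M ->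
  (forall x, `|x| <= 1 -> `|f x| <= M) -> opnorm f <= M.
Proof.
move=> M0 fM; rewrite /opnorm -(nC M0) lecR.
by apply: ge_sup; [exact: opset0 | exact: opset_ub].
Qed.

Lemma opnorm_le f (M : R[i]) : 0 <= M ->
  (forall x, `|f x| <= M * `|x|) -> opnorm f <= M.
Proof.
move=> M0 fM; apply: opnorm_le1 => // x x1.
by apply: le_trans (fM x) _; rewrite ler_piMr.
Qed.

Lemma opnormD f g : opnorm (f + g) <= opnorm f + opnorm g.
Proof.
apply: opnorm_le => [|x]; first by rewrite addr_ge0// opnorm_ge0.
rewrite bounded_opDE (le_trans (ler_normD _ _))// mulrDl lerD// le_opnorm//.
Qed.

Lemma opnormZ (k : R[i]) f : opnorm (k *: f) = `|k| * opnorm f.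
Proof.
have le1 l h : opnorm (l *: h) <= `|l| * opnorm h.
  apply: opnorm_le => [|x]; first by rewrite mulr_ge0// opnorm_ge0.
  by rewrite bounded_opZE normrZ -mulrA ler_wpM2l// le_opnorm.
apply/le_anti; rewrite le1/=.
have [->|k0] := eqVneq k 0; first by rewrite normr0 mul0r opnorm_ge0.
rewrite -ler_pdivlMl ?normr_gt0// -normfV.
by rewrite -[X in opnorm X <= _](scalerK k0).
Qed.

Lemma opnorm0_eq0 f : opnorm f = 0 -> f = 0.
Proof.
move=> f0; apply: bounded_op_ext => x; apply/normr0_eq0/le_anti.
by rewrite normr_ge0 andbT (le_trans (le_opnorm f x))// f0 mul0r.
Qed.

HB.instance Definition _ :=
  Lmodule_isNormed.Build R[i] bounded_op opnormD opnormZ opnorm0_eq0.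

Lemma bounded_op_normE f : `|f| = opnorm f. Proof. by []. Qed.

Lemma le_op_norm f x : `|f x| <= `|f| * `|x|.
Proof. exact: le_opnorm. Qed.

Lemma op_norm_le f (M : R[i]) : 0 <= M ->
  (forall x, `|f x| <= M * `|x|) -> `|f| <= M.
Proof. exact: opnorm_le. Qed.

End BoundedOp.

Lemma norm_cauchy_cvg (K : numFieldType) (V : completeNormedModType K)
    (F : set_system V) : ProperFilter F ->
  (forall e : K, 0 < e -> exists v, F [set x | `|v - x| < e]) ->
  exists l : V, F --> l.
Proof.
move=> PF cF; apply/cvg_ex; apply: cauchy_cvg; apply: cauchy_exP => e e0.
by have [v Fv] := cF e e0; exists v; rewrite -ball_normE.
Qed.

Lemma cvg_norm_ball (K : numFieldType) (V : normedModType K)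
    (F : set_system V) (l : V) (e : K) : ProperFilter F -> F --> l -> 0 < e ->
  F [set x | `|l - x| < e].
Proof. by move=> PF /cvgr_dist_lt; exact. Qed.

Section BoundedOpComplete.
Variables (R : realType) (V : normedModType R[i]).
Variable W : completeNormedModType R[i].

Lemma bounded_op_cauchy_cvg (F : set_system (bounded_op V W)) :
  ProperFilter F -> cauchy F -> cvg F.
Proof.
move=> PF /cauchyP cF.
have {}cF e : 0 < e -> exists f0 : bounded_op V W, F [set f | `|f0 - f| < e].
  by move=> /cF[f0]; rewrite -ball_normE => Ff0; exists f0.
have evcvg x : exists l : W, (fun f : bounded_op V W => f x) @ F --> l.
  apply: norm_cauchy_cvg => e e0.
  have x1 : 0 < `|x| + 1 by rewrite ltr_wpDl.
  have [f0 Ff0] := cF (e / (`|x| + 1)) (divr_gt0 e0 x1).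
  exists (f0 x); rewrite nbhs_filterE/=.
  apply: (@filterS _ F _ _ _ _ Ff0) => f /= f0f.
  rewrite -(bounded_opBE f0 f) (le_lt_trans (le_op_norm _ _))//.
  rewrite (le_lt_trans (_ : _ <= `|f0 - f| * (`|x| + 1)))//.
    by rewrite ler_wpM2l// lerDl.
  by rewrite -ltr_pdivlMr.
have [h hP] := choice evcvg.
have lh : linear h.
  move=> k x y; apply: (cvg_unique _ (hP _)) => //.
  have -> : (fun f : bounded_op V W => f (k *: x + y)) =
            (fun f : bounded_op V W => k *: f x + f y).
    by apply/funext => f; rewrite linearP.
  by apply: cvgD => //; apply: cvgZl_tmp.
have near_h (f0 : bounded_op V W) (e : R[i]) : 0 < e ->
    F [set f | `|f0 - f| < e] -> forall x, `|f0 x - h x| <= e * `|x|.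
  move=> e0 Ff0 x; apply/ler_addgt0Pr => d d0.
  have Fx : F [set f : bounded_op V W | `|h x - f x| < d].
    exact: (cvg_norm_ball _ (hP x) d0).
  have [f [f0f fh]] := filter_ex (filterI Ff0 Fx).
  rewrite (le_trans (ler_distD (f x) _ _))// lerD//.
    rewrite -(bounded_opBE f0 f) (le_trans (le_op_norm _ _))// ler_wpM2r//.
    exact: ltW.
  by rewrite distrC ltW.
have [g hg] : exists g : bounded_op V W, bounded_op_fun g = h.
  have [f0 Ff0] := cF 1 ltr01.
  suff hb : h \in @bounded_op_pred R V W by exists (BoundedOp hb).
  apply: (@bounded_opP_bound _ _ _ _ (`|f0| + 1)) => // x.
  rewrite -[h x](subrK (f0 x)) addrC mulrDl (le_trans (ler_normD _ _))// lerD//.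
    exact: le_op_norm.
  by rewrite distrC near_h.
apply/cvg_ex; exists g; apply/cvgrPdist_le => e e0.
have e2 : 0 < e / 2 by rewrite divr_gt0.
have [f0 Ff0] := cF _ e2.
apply: filterS (Ff0) => f /= f0f; rewrite (splitr e).
apply: (le_trans (ler_distD f0 _ _)); apply: lerD; last exact: ltW.
rewrite distrC; apply: op_norm_le => [|x]; first exact: ltW.
by rewrite bounded_opBE hg; apply: near_h.
Qed.

HB.instance Definition _ :=
  Uniform_isComplete.Build (bounded_op V W) bounded_op_cauchy_cvg.

End BoundedOpComplete.

Section Comp.
Variables (R : realType) (U V W : normedModType R[i]).

Lemma comp_op_subproof (f : bounded_op V W) (g : bounded_op U V) :
  f \o g \in @bounded_op_pred R U W.
Proof.
apply: (@bounded_opP_bound _ _ _ _ (`|f| * `|g|)) => [k x y|x].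
  by rewrite /= !linearP.
rewrite /= (le_trans (le_op_norm _ _))// -mulrA ler_wpM2l//.
exact: le_op_norm.
Qed.

Definition comp_op f g : bounded_op U W := BoundedOp (comp_op_subproof f g).

Lemma comp_opE f g x : comp_op f g x = f (g x). Proof. by []. Qed.

Lemma comp_op_normM f g : `|comp_op f g| <= `|f| * `|g|.
Proof.
apply: op_norm_le => [|x]; first by rewrite mulr_ge0.
rewrite comp_opE (le_trans (le_op_norm _ _))// -mulrA ler_wpM2l//.
exact: le_op_norm.
Qed.

Lemma comp_opBE f f' g g' :
  comp_op f g - comp_op f' g' = comp_op (f - f') g + comp_op f' (g - g').
Proof.
apply: bounded_op_ext => x.
rewrite bounded_opBE bounded_opDE !comp_opE !bounded_opBE linearB.
by rewrite addrA subrK.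
Qed.

Lemma cvg_comp_op T (F : set_system T) (FF : Filter F)
    (u : T -> bounded_op V W) (v : T -> bounded_op U V) f g :
  u @ F --> f -> v @ F --> g ->
  (fun t => comp_op (u t) (v t)) @ F --> comp_op f g.
Proof.
move=> uf vg; apply/subr_cvg0/cvgr0Pnorm_lt => e e0.
have b0 : (fun t => `|u t - f| * `|v t| + `|f| * `|v t - g|) @ F --> (0 : R[i]^o).
  rewrite -[X in _ --> X]addr0; apply: cvgD.
    rewrite -[X in _ --> X](mul0r `|g|); apply: cvgM; last exact: cvg_norm.
    by apply/norm_cvg0P/subr_cvg0.
  rewrite -[X in _ --> X](mulr0 `|f|); apply: cvgM; first exact: cvg_cst.
  by apply/norm_cvg0P/subr_cvg0.
move/cvgr0Pnorm_lt : b0 => /(_ e e0); apply: filterS => t /=.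
apply: le_lt_trans; rewrite ger0_norm ?addr_ge0 ?mulr_ge0//.
rewrite comp_opBE (le_trans (ler_normD _ _))// lerD// comp_op_normM//.
Qed.
End Comp.

(* Linear in the first variable, conjugate linear in the second. *)
HB.mixin Record NormedModule_isInner (R : realType) H & NormedModule R[i] H := {
  inner : {dot H for (@Num.conj R[i])};
  inner_norm : forall x : H, inner x x = `|x| ^+ 2
}.

#[short(type="hilbertType")]
HB.structure Definition Hilbert (R : realType) :=
  {H of CompleteNormedModule R[i] H & NormedModule_isInner R H}.

Section Algebra.
Variable K : fieldType.
Implicit Types a b c d e p n : K.

Lemma proj_algebra a b p n : n != 0 ->
  p - b / n * a - (a / n * b - a / n * (b / n * n)) = p - a * b / n.
Proof. by move=> n0; field. Qed.

Lemma parallelogram_algebra a b c d :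
  (a - b - (c - d)) + (a + b + (c + d)) = 2 * a + 2 * d.
Proof. by ring. Qed.

Lemma riesz_algebra d e : 4 * e = 2 * (d + e) + 2 * (d + e) - 2 ^+ 2 * d.
Proof. by ring. Qed.

End Algebra.

Section HilbertTheory.
Variables (R : realType) (H : hilbertType R).
Implicit Types x y z : H.

Local Notation "''[' x , y ]" := (@inner R H x y).
Local Notation cj := (@Num.conj R[i]).

Lemma innerC x y : '[x, y] = cj '[y, x].
Proof. by rewrite (hermC (@inner R H)) expr0 mul1r. Qed.

Lemma innerDl x y z : '[x + y, z] = '[x, z] + '[y, z].
Proof. exact: linearDl. Qed.

Lemma innerDr x y z : '[x, y + z] = '[x, y] + '[x, z].
Proof. exact: linearDr. Qed.

Lemma innerBl x y z : '[x - y, z] = '[x, z] - '[y, z].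
Proof. exact: linearBl. Qed.

Lemma innerBr x y z : '[x, y - z] = '[x, y] - '[x, z].
Proof. exact: linearBr. Qed.

Lemma innerZl (k : R[i]) x y : '[k *: x, y] = k * '[x, y].
Proof. exact: linearZl_LR. Qed.

Lemma innerZr (k : R[i]) x y : '[x, k *: y] = cj k * '[x, y].
Proof. exact: linearZr_LR. Qed.

Lemma inner0l y : '[0, y] = 0.
Proof. exact: linear0l. Qed.

Lemma inner0r x : '[x, 0] = 0.
Proof. exact: linear0r. Qed.

Lemma inner_ext x y : (forall z, '[z, x] = '[z, y]) -> x = y.
Proof.
move=> xy; apply/eqP; rewrite -subr_eq0 -normr_eq0 -sqrf_eq0 -inner_norm.
by rewrite innerBr xy subrr.
Qed.

Lemma norm_sub_proj x y : y != 0 ->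
  `|x - ('[x, y] / `|y| ^+ 2) *: y| ^+ 2 =
  `|x| ^+ 2 - `|'[x, y]| ^+ 2 / `|y| ^+ 2.
Proof.
move=> y0; have ny : `|y| ^+ 2 != 0 by rewrite expf_neq0// normr_eq0.
have cny : cj (`|y| ^+ 2) = `|y| ^+ 2.
  by apply/CrealP; rewrite realX// normr_real.
have cE : cj ('[x, y] / `|y| ^+ 2) = cj '[x, y] / `|y| ^+ 2.
  by rewrite rmorphM fmorphV/= cny.
rewrite normCK -inner_norm innerBl !innerBr !innerZl !innerZr cE !inner_norm.
by rewrite (innerC y x); exact: proj_algebra.
Qed.

Lemma CauchySchwarz_inner x y : `|'[x, y]| <= `|x| * `|y|.
Proof.
have [->|y0] := eqVneq y 0; first by rewrite inner0r !normr0 mulr0.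
have ny : 0 < `|y| ^+ 2 by rewrite exprn_gt0// normr_gt0.
rewrite -(@ler_pXn2r _ 2) ?nnegrE ?mulr_ge0// exprMn -ler_pdivrMr//.
by rewrite -subr_ge0 -norm_sub_proj// exprn_ge0.
Qed.

Lemma parallelogram x y :
  `|x - y| ^+ 2 + `|x + y| ^+ 2 = 2 * `|x| ^+ 2 + 2 * `|y| ^+ 2.
Proof.
rewrite -!inner_norm !innerBl !innerBr !innerDl !innerDr.
exact: parallelogram_algebra.
Qed.

Lemma innerl_bounded y : (fun x => '[x, y] : R[i]^o) \in
  @bounded_op_pred R H R[i]^o.
Proof.
apply: (@bounded_opP_bound _ _ _ _ `|y|) => [k x z|x].
  by rewrite innerDl innerZl.
by rewrite mulrC CauchySchwarz_inner.
Qed.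

Lemma riesz (f : bounded_op H R[i]^o) : exists z, forall x, f x = '[x, z].
Proof.
have [[e0 fe0]|/forallNP f0] := pselect (exists e, f e != 0); last first.
  exists 0 => x; rewrite inner0r; apply/eqP/negPn/negP; exact: f0.
pose A := [set x | f x = 1].
have Ae : A ((f e0)^-1 *: e0) by rewrite /A/= linearZ/=; exact: mulVf.
pose B := [set complex.Re (`|x| ^+ 2) | x in A].
have nC x : (complex.Re (`|x| ^+ 2))%:C = `|x| ^+ 2.
  by rewrite RRe_real// realX// normr_real.
have Blb : lbound B 0.
  by move=> _ [x _ <-]; rewrite -ler0c nC exprn_ge0.
have Bi : has_inf B.
  by split; [exists (complex.Re (`|(f e0)^-1 *: e0| ^+ 2)), ((f e0)^-1 *: e0)
            | exists 0].
pose d := (inf B)%:C.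
have d_le x : A x -> d <= `|x| ^+ 2.
  by move=> Ax; rewrite -nC lecR; apply: ge_inf; [exists 0 | exists x].
have d_lt (e : R[i]) : 0 < e -> exists2 x, A x & `|x| ^+ 2 < d + e.
  move=> egt0; have eC : (complex.Re e)%:C = e by rewrite RRe_real// gtr0_real.
  have re0 : 0 < complex.Re e by rewrite -ltcR eC.
  have [_ [x Ax <-] xd] := inf_adherent re0 Bi.
  by exists x => //; rewrite -nC -eC /d -rmorphD ltcR.
pose Ae' (e : R[i]) := [set x | A x /\ `|x| ^+ 2 < d + e].
pose F := filter_from [set e : R[i] | 0 < e] Ae'.
have FF : ProperFilter F.
  apply: filter_from_proper; last by move=> e /d_lt[x Ax xd]; exists x.
  apply: filter_from_filter; first by exists 1 => /=.
  move=> e1 e2 /= e10 e20.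
  have /comparable_minr e12 : (e1 >=< e2)%O.
    by rewrite real_comparable// gtr0_real.
  have cmp : (e1 <= e2) || (e2 <= e1) by rewrite real_leVge// gtr0_real.
  case/orP: cmp => le12; [exists e1 => // | exists e2 => //] => x [Ax xd].
  - by split; split=> //; rewrite (lt_le_trans xd)// lerD2l.
  - by split; split=> //; rewrite (lt_le_trans xd)// lerD2l.
have FA e : 0 < e -> F (Ae' e) by move=> egt0; exists e.
have f_half x y : A x -> A y -> A (2^-1 *: (x + y)).
  rewrite /A/= => fx fy; rewrite linearZ linearD/= fx fy.
  by rewrite -mulr2n -[_ *: _]/(_ * _) mulVf.
have near_A e x y : Ae' e x -> Ae' e y -> `|x - y| ^+ 2 < 4 * e.
  move=> [Ax xd] [Ay yd]; have := d_le _ (f_half _ _ Ax Ay).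
  rewrite normrZ exprMn normfV ger0_norm// exprVn.
  rewrite ler_pdivlMl ?exprn_gt0// => dxy.
  have -> : `|x - y| ^+ 2 =
      2 * `|x| ^+ 2 + 2 * `|y| ^+ 2 - `|x + y| ^+ 2.
    by rewrite -parallelogram addrK.
  have -> : 4 * e = 2 * (d + e) + 2 * (d + e) - 2 ^+ 2 * d by exact: riesz_algebra.
  by apply: ltr_leB => //; apply: ltrD; rewrite ltr_pM2l.
have [z zP] : exists z, F --> z.
  apply: norm_cauchy_cvg => e egt0.
  have e4 : 0 < e ^+ 2 / 4 by rewrite divr_gt0// exprn_gt0.
  have [x Ax xd] := d_lt _ e4.
  exists x; apply: filterS (FA _ e4) => y /= Ay.
  rewrite -(@ltr_pXn2r _ 2) ?nnegrE// ?(ltW egt0)//.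
  by rewrite (lt_le_trans (near_A _ _ _ (conj Ax xd) Ay))// mulrC divfK.
have fz : f z = 1.
  apply/esym; apply: (@cvg_unique _ _ (f @ F)) => //; last first.
    by apply: cvg_comp zP _; exact: bounded_op_continuous.
  apply: cvg_near_cst; apply: filterS (FA _ ltr01) => x [Ax _].
  exact: Ax.
have z0 : z != 0.
  by apply/eqP => z0; move/eqP: fz; rewrite z0 linear0 eq_sym oner_eq0.
have zd : `|z| ^+ 2 <= d.
  have cz : (fun x : H => `|x| ^+ 2 : R[i]^o) @ F --> (`|z| ^+ 2 : R[i]^o).
    rewrite expr2; under eq_fun do rewrite expr2.
    by apply: cvgM; apply: cvg_norm.
  apply/ler_addgt0Pr => e egt0.
  have e2 : 0 < e / 2 by rewrite divr_gt0.
  have Fz : F [set x | `| `|z| ^+ 2 - `|x| ^+ 2 | < e / 2].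
    exact: (cvg_norm_ball _ cz e2).
  have [x [zx [_ xd]]] := filter_ex (filterI Fz (FA _ e2)).
  have -> : d + e = (d + e / 2) + e / 2 by rewrite -addrA -splitr.
  rewrite -(subrK (`|x| ^+ 2) (`|z| ^+ 2)) addrC.
  apply: lerD; first exact: ltW.
  apply: le_trans (ltW zx); apply: real_ler_norm.
  by rewrite realB// realX// normr_real.
have z_ker w : f w = 0 -> '[z, w] = 0.
  move=> fw; have [->|w0] := eqVneq w 0; first by rewrite inner0r.
  have nw : 0 < `|w| ^+ 2 by rewrite exprn_gt0// normr_gt0.
  have Az : A (z - ('[z, w] / `|w| ^+ 2) *: w).
    by rewrite /A/= linearB linearZ/= fw fz scaler0 subr0.
  have := le_trans zd (d_le _ Az); rewrite norm_sub_proj//.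
  rewrite lerBrDr gerDl pmulr_lle0 ?invr_gt0// => le0.
  apply/eqP; rewrite -normr_eq0 -sqrf_eq0; apply/eqP/le_anti.
  by rewrite le0 exprn_ge0.
have nz : `|z| ^+ 2 != 0 by rewrite expf_neq0// normr_eq0.
exists ((`|z| ^+ 2)^-1 *: z) => x.
have /z_ker : f (x - f x *: z) = 0.
  by rewrite linearB linearZ/= fz -[_ *: _]/(_ * _) mulr1 subrr.
rewrite innerBr innerZr inner_norm => /eqP; rewrite subr_eq0 => /eqP zx.
rewrite innerZr innerC zx rmorphM/= Num.Theory.conjCK.
have cz : cj (`|z| ^+ 2) = `|z| ^+ 2.
  by apply/CrealP; rewrite realX// normr_real.
by rewrite fmorphV/= !cz mulrCA mulVf// mulr1.
Qed.

Lemma adjoint_ex (T : bounded_op H H) :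
  exists S : bounded_op H H, forall x y, '[T x, y] = '[x, S y].
Proof.
have bT y : (fun x => '[T x, y] : R[i]^o) \in @bounded_op_pred R H R[i]^o.
  apply: (@bounded_opP_bound _ _ _ _ (`|T| * `|y|)) => [k x z|x].
    by rewrite linearP innerDl innerZl.
  rewrite (le_trans (CauchySchwarz_inner _ _))// mulrAC ler_wpM2r//.
  exact: le_op_norm.
have [S SP] := choice (fun y => riesz (BoundedOp (bT y))).
have {}SP x y : '[T x, y] = '[x, S y] by rewrite -SP.
suff bS : S \in @bounded_op_pred R H H by exists (BoundedOp bS).
apply: (@bounded_opP_bound _ _ _ _ `|T|) => [k x y|x].
  by apply: inner_ext => z; rewrite -SP !innerDr !innerZr !SP.
have [->|Sx0] := eqVneq (S x) 0; first by rewrite normr0 mulr_ge0.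
rewrite -(@ler_pM2r _ `|S x|) ?normr_gt0// -expr2 -inner_norm -SP.
rewrite -[leLHS]ger0_norm; last by rewrite SP inner_norm exprn_ge0.
rewrite (le_trans (CauchySchwarz_inner _ _))// mulrAC ler_wpM2r//.
exact: le_op_norm.
Qed.

Definition adjoint (T : bounded_op H H) : bounded_op H H :=
  projT1 (cid (adjoint_ex T)).

Lemma adjointP (T : bounded_op H H) x y : '[T x, y] = '[x, adjoint T y].
Proof. by rewrite /adjoint; case: cid. Qed.

Lemma adjointPr (T : bounded_op H H) x y : '[x, T y] = '[adjoint T x, y].
Proof. by rewrite innerC adjointP -innerC. Qed.

Lemma adjoint_uniq (T S : bounded_op H H) : (forall x y, '[T x, y] = '[x, S y]) -> adjoint T = S.
Proof.
move=> TS; apply: bounded_op_ext => y; apply: inner_ext => x.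
by rewrite -adjointP TS.
Qed.

Lemma adjointK T : adjoint (adjoint T) = T.
Proof. by apply: adjoint_uniq => x y; rewrite adjointPr. Qed.

Lemma adjointP_lin (k : R[i]) T S :
  adjoint (k *: T + S) = cj k *: adjoint T + adjoint S.
Proof.
apply: adjoint_uniq => x y.
rewrite !bounded_opDE !bounded_opZE innerDl innerDr innerZl innerZr.
by rewrite Num.Theory.conjCK !adjointP.
Qed.

Lemma adjointB T S : adjoint (T - S) = adjoint T - adjoint S.
Proof.
by rewrite addrC -scaleN1r adjointP_lin rmorphN rmorph1 scaleN1r addrC.
Qed.

Lemma adjoint_comp T S :
  adjoint (comp_op T S) = comp_op (adjoint S) (adjoint T).
Proof. by apply: adjoint_uniq => x y; rewrite /= !adjointP. Qed.

Lemma adjoint_norm_le T : `|adjoint T| <= `|T|.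
Proof.
apply: op_norm_le => // x.
have [->|Sx0] := eqVneq (adjoint T x) 0; first by rewrite normr0 mulr_ge0.
rewrite -(@ler_pM2r _ `|adjoint T x|) ?normr_gt0// -expr2 -inner_norm -adjointP.
rewrite -[leLHS]ger0_norm; last by rewrite adjointP inner_norm exprn_ge0.
rewrite (le_trans (CauchySchwarz_inner _ _))// mulrAC ler_wpM2r//.
exact: le_op_norm.
Qed.

Lemma cvg_adjoint I (F : set_system I) (FF : Filter F)
    (u : I -> bounded_op H H) T :
  u @ F --> T -> (fun t => adjoint (u t)) @ F --> adjoint T.
Proof.
move=> /cvgrPdist_lt uT; apply/cvgrPdist_lt => e e0.
apply: filterS (uT e e0) => t; apply: le_lt_trans.
by rewrite -adjointB adjoint_norm_le.
Qed.

End HilbertTheory.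

(* [tprod a b c] is the triple product {a, b, c}; [tprod_jordan] is the Jordan
   identity
   L(a,b) L(x,y) - L(x,y) L(a,b) = L(L(a,b) x, y) - L(x, L(b,a) y),
   where L(a,b) x = {a, b, x}, evaluated at z. *)
HB.mixin Record NormedModule_isJordanTriple (R : realType) E
    & NormedModule R[i] E := {
  tprod : E -> E -> E -> E;
  tprodC : forall a b c, tprod a b c = tprod c b a;
  tprod_linear : forall b c, linear (fun a => tprod a b c);
  tprod_conj_linear : forall a c,
    linear_for (@Num.conj R[i] \; *:%R) (fun b => tprod a b c);
  tprod_continuous : continuous (fun p : E * E * E => tprod p.1.1 p.1.2 p.2);
  tprod_jordan : forall a b x y z,
    tprod a b (tprod x y z) =
    tprod (tprod a b x) y z - tprod x (tprod b a y) z + tprod x y (tprod a b z)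
}.

#[short(type="jordanBanachTripleType")]
HB.structure Definition JordanBanachTriple (R : realType) :=
  {E of CompleteNormedModule R[i] E & NormedModule_isJordanTriple R E}.

Lemma tprod_linearr (R : realType) (E : jordanBanachTripleType R) (a b : E) :
  linear (tprod a b).
Proof. by move=> k x y; rewrite !(tprodC a b) tprod_linear. Qed.

Section Compact.
Variables (R : realType).

Lemma precompact_approx (V : completeNormedModType R[i]) (S : set V) :
  (forall e : R[i], 0 < e -> exists2 K : set V, compact K &
     forall s, S s -> exists2 k, K k & `|s - k| < e) -> precompact S.
Proof.
move=> SK; rewrite precompactE compact_ultra => G GU GS.
have cauchyG (e : R[i]) : 0 < e -> exists v, G [set x | `|v - x| < e].
  move=> e0; have e3 : 0 < e / 3 by rewrite divr_gt0.
  have [K cK KP] := SK _ e3.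
  have /choice[p pP] (s : V) : exists k, closure S s -> K k /\ `|s - k| < e / 3 + e / 3.
    have [clSs|nS] := pselect (closure S s); last by exists s.
    have [s' [Ss' ss']] := clSs _ (nbhsx_ballx s _ e3).
    have [k Kk s'k] := KP _ Ss'; exists k => _; split=> //.
    rewrite (le_lt_trans (ler_distD s' _ _))// ltrD//.
    by move: ss'; rewrite -ball_normE.
  have GK : (p @ G) K.
    by apply: (@filterS _ G _ _ _ _ GS) => s /pP[].
  have [k [Kk clk]] := cK (p @ G) _ GK.
  have bk := nbhsx_ballx k _ e3.
  have Gk : G (p @^-1` ball k (e / 3)).
    have [//|Gn] := in_ultra_setVsetC (p @^-1` ball k (e / 3)) GU.
    by have [x [nx]] := clk (~` ball k (e / 3)) _ Gn bk.
  exists k; apply: (@filterS _ G _ _ _ _ (filterI Gk GS)) => s [/= pk /pP[_ sp]].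
  rewrite (le_lt_trans (ler_distD (p s) _ _))//.
  have -> : e = e / 3 + (e / 3 + e / 3).
    by rewrite -!mulrDl -mulr2n -mulrS -[e *+ 3]mulr_natr mulfK.
  apply: ltrD; first by move: pk; rewrite -ball_normE.
  by rewrite distrC.
have [l Gl] := norm_cauchy_cvg _ cauchyG.
exists l; split=> //; apply: closed_closure => A Al.
by have [x [Sx Ax]] := filter_ex (filterI GS (Gl _ Al)); exists x.
Qed.

(* K(H), with the norm of bounded_op H H *)
Section CompactOp.
Variable H : hilbertType R.

Definition unit_ball : set H := [set x | `|x| <= 1].

Definition compact_op_pred : {pred bounded_op H H} :=
  [pred T : bounded_op H H | `[< precompact [set T x | x in unit_ball] >]].

Record compact_op := CompactOp {
  compact_op_val :> bounded_op H H;
  compact_opP : compact_op_val \in compact_op_pred }.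

HB.instance Definition _ := [isSub for compact_op_val].
HB.instance Definition _ := [Choice of compact_op by <:].

Lemma compact_op_predP (T : bounded_op H H) :
  reflect (precompact [set T x | x in unit_ball]) (T \in compact_op_pred).
Proof. by rewrite inE; apply: asboolP. Qed.

Lemma compact_op_submod_closed : submod_closed compact_op_pred.
Proof.
split=> [|k f g].
  apply/compact_op_predP.
  apply: (@precompact_subset _ _ [set 0]) => [_ [x _ <-]//|].
  by apply: compact_precompact; [exact: norm_hausdorff | exact: compact_set1].
move=> /compact_op_predP + /compact_op_predP.
rewrite !precompactE => cf cg; apply/compact_op_predP.
pose h (p : H * H) : H := k *: p.1 + p.2.
have ch : continuous h.
  move=> p; apply: cvgD; last exact: cvg_snd.
  by apply: cvgZl_tmp; exact: cvg_fst.
apply: (@precompact_subset _ _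
  (h @` (closure [set f x | x in unit_ball] `*` closure [set g x | x in unit_ball]))).
  move=> _ [x x1 <-]; exists (f x, g x) => //; split; apply: subset_closure.
    by exists x.
  by exists x.
apply: compact_precompact; first exact: norm_hausdorff.
apply: continuous_compact; first exact: continuous_subspaceT.
exact: compact_setX.
Qed.

HB.instance Definition _ :=
  GRing.isSubmodClosed.Build R[i] (bounded_op H H) compact_op_pred
    compact_op_submod_closed.
HB.instance Definition _ := [SubChoice_isSubLmodule of compact_op by <:].

Definition compact_op_norm (T : compact_op) : R[i] := `|compact_op_val T|.

Lemma compact_op_normD (S T : compact_op) :
  compact_op_norm (S + T) <= compact_op_norm S + compact_op_norm T.
Proof. exact: ler_normD. Qed.

Lemma compact_op_normZ (k : R[i]) (T : compact_op) :
  compact_op_norm (k *: T) = `|k| * compact_op_norm T.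
Proof. exact: normrZ. Qed.

Lemma compact_op_norm0_eq0 (T : compact_op) : compact_op_norm T = 0 -> T = 0.
Proof. by move=> /normr0_eq0 T0; apply: val_inj. Qed.

HB.instance Definition _ := Lmodule_isNormed.Build R[i] compact_op
  compact_op_normD compact_op_normZ compact_op_norm0_eq0.

Lemma compact_op_normE (T : compact_op) : `|T| = `|compact_op_val T|.
Proof. by []. Qed.

Lemma compact_op_valB (S T : compact_op) :
  compact_op_val (S - T) = compact_op_val S - compact_op_val T.
Proof. by []. Qed.

Lemma compact_op_closed (T : bounded_op H H) :
  (forall e : R[i], 0 < e -> exists S : compact_op, `|T - compact_op_val S| < e) ->
  T \in compact_op_pred.
Proof.
move=> TS; apply/compact_op_predP; apply: precompact_approx => e /TS[S TSe].
exists (closure [set S x | x in unit_ball]).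
  by rewrite -precompactE; apply/compact_op_predP; exact: compact_opP.
move=> _ [x x1 <-]; exists (S x); first by apply: subset_closure; exists x.
rewrite -bounded_opBE (le_lt_trans (le_op_norm _ _))//.
by rewrite (le_lt_trans _ TSe)// ler_piMr.
Qed.

Lemma compact_op_cauchy_cvg (F : set_system compact_op) :
  ProperFilter F -> cauchy F -> cvg F.
Proof.
move=> PF /cauchyP cF.
have {}cF (e : R[i]) : 0 < e -> exists f0 : compact_op, F [set f | `|f0 - f| < e].
  by move=> /cF[f0]; rewrite -ball_normE => Ff0; exists f0.
have [T FT] : exists T : bounded_op H H, compact_op_val @ F --> T.
  apply: norm_cauchy_cvg => e /cF[f0 Ff0].
  by exists (compact_op_val f0).
have FTe (e : R[i]) : 0 < e -> F [set f | `|T - compact_op_val f| < e].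
  by move=> e0; exact: (cvg_norm_ball _ FT e0).
have cT : T \in compact_op_pred.
  by apply: compact_op_closed => e /FTe /filter_ex[S ST]; exists S.
by apply/cvg_ex; exists (CompactOp cT); apply/cvgrPdist_lt => e /FTe.
Qed.

HB.instance Definition _ :=
  Uniform_isComplete.Build compact_op compact_op_cauchy_cvg.

Lemma compact_comp_opl (S T : bounded_op H H) :
  T \in compact_op_pred -> comp_op S T \in compact_op_pred.
Proof.
move=> /compact_op_predP; rewrite precompactE => cT; apply/compact_op_predP.
apply: (@precompact_subset _ _ (S @` closure [set T x | x in unit_ball])).
  move=> _ [x x1 <-]; exists (T x) => //.
  by apply: subset_closure; exists x.
apply: compact_precompact; first exact: norm_hausdorff.
apply: continuous_compact => //; apply: continuous_subspaceT.
exact: bounded_op_continuous.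
Qed.

Lemma compact_comp_opr (S T : bounded_op H H) :
  T \in compact_op_pred -> comp_op T S \in compact_op_pred.
Proof.
move=> /compact_op_predP; rewrite precompactE => cT; apply/compact_op_predP.
apply: (@precompact_subset _ _
  ((fun y => `|S| *: y) @` closure [set T x | x in unit_ball])).
  move=> _ [x x1 <-].
  have [S0|S0] := eqVneq S 0.
    exists (T 0); first by apply: subset_closure; exists 0; rewrite //= /unit_ball/= normr0.
    by rewrite S0 normr0 scale0r comp_opE linear0.
  have nS : `|S| != 0 by rewrite normr_eq0.
  exists (T (`|S|^-1 *: S x)); last by rewrite -linearZ/= scalerA mulfV// scale1r.
  apply: subset_closure; exists (`|S|^-1 *: S x) => //.
  rewrite /unit_ball/= normrZ normfV normr_id ler_pdivrMl ?normr_gt0// mulr1.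
  by rewrite (le_trans (le_op_norm _ _))// ler_piMr.
apply: compact_precompact; first exact: norm_hausdorff.
apply: continuous_compact => //; apply: continuous_subspaceT => y.
by apply: cvgZl_tmp; exact: cvg_id.
Qed.

Lemma compact_tprod_subproof (a b c : compact_op) :
  2^-1 *: (comp_op a (comp_op (adjoint b) c) + comp_op c (comp_op (adjoint b) a))
    \in compact_op_pred.
Proof.
by rewrite rpredZ// rpredD// compact_comp_opl// compact_comp_opl// compact_opP.
Qed.

(* {a, b, c} = (a b^* c + c b^* a) / 2 *)
Definition compact_tprod a b c : compact_op :=
  CompactOp (compact_tprod_subproof a b c).

Lemma compact_op_ext (S T : compact_op) : (forall x, S x = T x) -> S = T.
Proof. by move=> ST; apply/val_inj/bounded_op_ext. Qed.

Lemma compact_tprodE a b c x :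
  compact_tprod a b c x =
  2^-1 *: (a (adjoint b (c x)) + c (adjoint b (a x))).
Proof. by []. Qed.

Lemma compact_tprodC a b c : compact_tprod a b c = compact_tprod c b a.
Proof. by apply: compact_op_ext => x; rewrite !compact_tprodE addrC. Qed.

Lemma compact_tprod_linear b c : linear (fun a => compact_tprod a b c).
Proof.
move=> k a a'; apply: compact_op_ext => x.
rewrite -[RHS]/(k *: compact_tprod a b c x + compact_tprod a' b c x).
rewrite !compact_tprodE.
have opE y : (k *: a + a') y = k *: a y + a' y by [].
rewrite !opE !linearP/=.
by rewrite addrACA -scalerDr [LHS]scalerDr; congr (_ + _); rewrite !scalerA mulrC.
Qed.

Lemma compact_tprod_conj_linear a c :
  linear_for (@Num.conj R[i] \; *:%R) (fun b => compact_tprod a b c).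
Proof.
move=> k b b'; apply: compact_op_ext => x.
rewrite -[RHS]/((Num.conj k) *: compact_tprod a b c x + compact_tprod a b' c x).
rewrite !compact_tprodE.
have -> : adjoint (k *: b + b') = Num.conj k *: adjoint b + adjoint b'.
  exact: adjointP_lin.
rewrite !bounded_opDE !bounded_opZE !linearP/=.
by rewrite addrACA -scalerDr [LHS]scalerDr; congr (_ + _); rewrite !scalerA mulrC.
Qed.

Lemma cvg_compact_op I (F : set_system I) (FF : Filter F)
    (u : I -> compact_op) T :
  u @ F --> T <-> (fun i => compact_op_val (u i)) @ F --> compact_op_val T.
Proof.
by split=> /cvgrPdist_lt uT; apply/cvgrPdist_lt => e e0;
  apply: filterS (uT e e0).
Qed.

Lemma compact_tprod_continuous :
  continuous (fun p : compact_op * compact_op * compact_op =>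
    compact_tprod p.1.1 p.1.2 p.2).
Proof.
move=> p; apply/(@cvg_compact_op _ (nbhs p)).
have c1 : (fun q : compact_op * compact_op * compact_op => compact_op_val q.1.1)
    @ nbhs p --> compact_op_val p.1.1.
  apply/cvg_compact_op.
  by apply: (@cvg_comp _ _ _ fst fst _ (nbhs p.1)); exact: cvg_fst.
have c2 : (fun q : compact_op * compact_op * compact_op => compact_op_val q.1.2)
    @ nbhs p --> compact_op_val p.1.2.
  apply/cvg_compact_op.
  apply: (@cvg_comp _ _ _ fst snd _ (nbhs p.1)); first exact: cvg_fst.
  exact: cvg_snd.
have c3 : (fun q : compact_op * compact_op * compact_op => compact_op_val q.2)
    @ nbhs p --> compact_op_val p.2.
  by apply/cvg_compact_op; exact: cvg_snd.
apply: cvgZl_tmp; apply: cvgD; apply: cvg_comp_op => //; apply: cvg_comp_op => //.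
- exact: cvg_adjoint.
- exact: cvg_adjoint.
Qed.

Let jordan_algebra (V : zmodType) (p1 p2 p3 p4 u1 u2 v1 v2 : V) :
  (p1 + p4) + (p3 + p2) =
  (p1 + u1 + (u2 + p2)) - (v1 + u1 + (u2 + v2)) + (v1 + p3 + (p4 + v2)).
Proof.
apply/eqP; rewrite eq_sym addrAC subr_eq; apply/eqP; rewrite !addrA.
by rewrite [LHS](ACl (1*7*6*4*5*2*3*8)).
Qed.

Let adjoint_tprod (b a y : compact_op) z :
  adjoint (compact_tprod b a y) z =
  2^-1 *: (adjoint y (a (adjoint b z)) + adjoint b (a (adjoint y z))).
Proof.
have -> : adjoint (compact_tprod b a y) =
   2^-1 *: (comp_op (adjoint y) (comp_op a (adjoint b)) +
            comp_op (adjoint b) (comp_op a (adjoint y))).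
  apply: adjoint_uniq => u v.
  rewrite compact_tprodE bounded_opZE bounded_opDE !comp_opE.
  rewrite innerZl innerZr innerDl innerDr.
  have -> : Num.conj (2^-1 : R[i]) = 2^-1.
    by apply/CrealP; rewrite realV realn.
  by rewrite !adjointP !adjointK addrC.
by [].
Qed.

Lemma compact_tprod_jordan a b x y z :
  compact_tprod a b (compact_tprod x y z) =
  compact_tprod (compact_tprod a b x) y z
  - compact_tprod x (compact_tprod b a y) z
  + compact_tprod x y (compact_tprod a b z).
Proof.
apply: compact_op_ext => v.
rewrite -[RHS]/(compact_tprod (compact_tprod a b x) y z v
  - compact_tprod x (compact_tprod b a y) z v
  + compact_tprod x y (compact_tprod a b z) v).
rewrite !compact_tprodE !adjoint_tprod.
rewrite !linearZ/= !linearD/= !scalerN -!opprD -!scalerDr -!scalerBr -!scalerDr.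
by congr (_ *: (_ *: _)); exact: jordan_algebra.
Qed.

HB.instance Definition _ := NormedModule_isJordanTriple.Build R compact_op
  compact_tprodC compact_tprod_linear compact_tprod_conj_linear
  compact_tprod_continuous compact_tprod_jordan.

End CompactOp.
End Compact.

Section TernaryDerivations.
Variables (R : realType) (E : jordanBanachTripleType R).

(* [R[i]^o] is R[i] as a normed module over itself. *)
Definition topdual := bounded_op E R[i]^o.

Implicit Types (a b c x : E) (phi : topdual).

Lemma tprod_continuous_comp (u v w : E -> E) :
  continuous u -> continuous v -> continuous w ->
  continuous (fun x => tprod (u x) (v x) (w x)).
Proof.
move=> cu cv cw x.
apply: (@continuous_comp _ _ _ (fun y => (u y, v y, w y))
  (fun p : E * E * E => tprod p.1.1 p.1.2 p.2)); last exact: tprod_continuous.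
have cuv : (fun y => (u y, v y)) @ nbhs x --> nbhs (u x, v x).
  by apply: cvg_pair; [exact: cu | exact: cv].
have := cvg_pair cuv (cw x); exact.
Qed.

Lemma dual_outer_subproof a b phi :
  (fun x => phi (tprod b a x)) \in @bounded_op_pred R E R[i]^o.
Proof.
apply: mk_bounded_op => [k x y|x].
  by rewrite tprod_linearr linearP.
apply: (@cvg_comp _ _ _ (tprod b a) phi _ (nbhs (tprod b a x))).
  by apply: (@tprod_continuous_comp (fun=> b) (fun=> a) id) => y;
    [exact: cvg_cst|exact: cvg_cst|exact: cvg_id].
exact: bounded_op_continuous.
Qed.

(* {a, b, phi} = {phi, b, a}, both equal to x |-> phi {b, a, x} *)
Definition dual_outer a b phi : topdual := BoundedOp (dual_outer_subproof a b phi).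

Lemma dual_middle_subproof a phi b :
  (fun x => Num.conj (phi (tprod a x b))) \in @bounded_op_pred R E R[i]^o.
Proof.
apply: mk_bounded_op => [k x y|x].
  by rewrite tprod_conj_linear linearP rmorphD rmorphM/= Num.Theory.conjCK.
apply: (@cvg_comp _ _ _ (fun x => phi (tprod a x b)) (@Num.conj R[i]) _
  (nbhs (phi (tprod a x b) : R[i]^o)) (nbhs (Num.conj (phi (tprod a x b)) : R[i]^o))).
  apply: (@cvg_comp _ _ _ (fun x => tprod a x b) phi _ (nbhs (tprod a x b))).
    by apply: (@tprod_continuous_comp (fun=> a) id (fun=> b)) => y;
      [exact: cvg_cst|exact: cvg_id|exact: cvg_cst].
  exact: bounded_op_continuous.
move: (phi _ : R[i]^o) => z; apply/(@cvgrPdist_lt _ R[i]^o _ (nbhs (z : R[i]^o))) => e e0.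
have zb : \forall w \near nbhs (z : R[i]^o), ball (z : R[i]^o) e w.
  exact: nbhsx_ballx.
apply: filterS zb => w; rewrite -ball_normE/= => zw.
by rewrite -rmorphB norm_conjC.
Qed.

(* {a, phi, b} : x |-> conj (phi {a, x, b}) *)
Definition dual_middle a phi b : topdual :=
  BoundedOp (dual_middle_subproof a phi b).

(* delta {a, b, c} =
     {delta a, b, c} + {a, delta b, c} + {a, b, delta c},
   where {delta a, b, c} = {c, b, delta a} is [dual_outer c b (delta a)]. *)
Definition ternary_derivation (delta : E -> topdual) : Prop :=
  linear_for (@Num.conj R[i] \; *:%R) delta /\
  forall a b c, delta (tprod a b c) =
    dual_outer c b (delta a) + dual_middle a (delta b) c
      + dual_outer a b (delta c).

(* delta(b, phi)(a) = {b, phi, a} - {phi, b, a} *)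
Definition inner_derivation_at b phi a : topdual :=
  dual_middle b phi a - dual_outer a b phi.

Definition inner_ternary_derivation (delta : E -> topdual) : Prop :=
  exists s : seq (E * topdual), forall a,
    delta a = \sum_(p <- s) inner_derivation_at p.1 p.2 a.

Definition ternary_weakly_amenable : Prop :=
  forall delta : E -> topdual, continuous delta -> ternary_derivation delta ->
    inner_ternary_derivation delta.

End TernaryDerivations.

Definition finite_dimensional (K : fieldType) (V : lmodType K) : Prop :=
  exists (n : nat) (e : 'I_n -> V),
    forall x : V, exists c : 'I_n -> K, x = \sum_(i < n) c i *: e i.

(* Main.v *)
Require Import Defs.
From mathcomp Require Import all_boot all_order all_algebra.
From mathcomp Require Import complex all_classical all_reals all_analysis.
From mathcomp Require Import sesquilinear ring.

(** The obstruction is the trace. Fix a unit vector [e], let [w h = '[h e, e]],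
    and let [delta x y = 'i * w (x' y - y x')], where [x'] is the adjoint of
    [x]. This is a continuous ternary derivation ([state_derivationP]): up to the
    involution it is the commutator with ['i] times the projection [p] on the
    line of [e]. Under the trace duality, an inner derivation has the form
    [x |-> P x' + x' Q] with [P], [Q] sums of [(b' c' - c b) / 2] and
    [(c' b' - b c) / 2], respectively, so [P] and [Q] have the same trace. If
    [delta] were inner, then [P - 'i p] and [Q + 'i p] would be opposite scalars;
    they are trace class and [H] is infinite dimensional, so that scalar is zero,
    and the traces of [P] and [Q] would be ['i] and [- 'i].

    The proof below follows this argument without the theory of trace class
    operators. Multiplication by [P] and [Q] is recorded by two functionals on
    bounded operators, [left_functional] and [right_functional], built from
    [h |-> phi (b h)] and [h |-> phi (h b)]. Evaluating the supposed equality at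
    partial isometries of rank one ([defect_rank1]) shows that the defect between
    them and [delta] takes one value [l] on all rank one projections, hence
    [n * l] on projections of rank [n] ([additive_orthoproj]); boundedness gives
    [l = 0]. Equality of traces is replaced by [functionals_close]: along the net
    of finite rank projections [f], the commutators [b f - f b] tend to [0] in
    norm for each compact [b] ([orthoproj_compl], [orthoproj_compr]), so the two
    functionals get arbitrarily close at [f], whereas [l = 0] keeps their values
    there at distance at least [2] as soon as [f e = e]. *)

Set Implicit Arguments.
Unset Strict Implicit.
Unset Printing Implicit Defensive.

Import Order.TTheory GRing.Theory Num.Theory.
Import numFieldNormedType.Exports.

Local Open Scope classical_set_scope.
Local Open Scope ring_scope.
Local Open Scope complex_scope.

(** * Rank one operators *)

Section RankOne.
Variables (R : realType) (H : hilbertType R).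
Implicit Types (u v x y : H).

Local Notation "''[' x , y ]" := (@inner R H x y).

Lemma rank1_subproof u v : (fun x => '[x, v] *: u) \in @bounded_op_pred R H H.
Proof.
apply: (@bounded_opP_bound _ _ _ _ (`|v| * `|u|)) => [k x y|x].
  by rewrite innerDl innerZl scalerDl scalerA.
by rewrite normrZ mulrAC ler_wpM2r// mulrC CauchySchwarz_inner.
Qed.

Definition rank1 u v : bounded_op H H := BoundedOp (rank1_subproof u v).

Lemma rank1E u v x : rank1 u v x = '[x, v] *: u. Proof. by []. Qed.

Lemma adjoint_rank1 u v : adjoint (rank1 u v) = rank1 v u.
Proof.
by apply: adjoint_uniq => x y; rewrite !rank1E innerZl innerZr -innerC mulrC.
Qed.

(** Bridge between the real and the complex topologies: [R] is normed over
    itself, while [H] is normed over [R[i]]. *)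
Lemma continuous_real_complex : continuous (fun a : R => a%:C : R[i]^o).
Proof.
move=> a; apply/(@cvgrPdist_lt _ R[i]^o) => e e0.
have eC : (complex.Re e)%:C = e by rewrite RRe_real// gtr0_real.
have re0 : 0 < complex.Re e by rewrite -ltcR eC.
have ab : \forall b \near nbhs a, ball a (complex.Re e) b by exact: nbhsx_ballx.
apply: filterS ab => b; rewrite -ball_normE/= => ab.
by rewrite -rmorphB normc_def /= expr0n addr0 sqrtr_sqr -eC ltcR.
Qed.

(** The unit ball is sent into the set of multiples [z *: u] with
    [`|z| <= `|v|], the image of the square of real and imaginary parts of
    modulus at most [`|v|], which is compact. *)
Lemma rank1_compact u v : rank1 u v \in @compact_op_pred R H.
Proof.
apply/compact_op_predP.
pose M := complex.Re `|v|; pose I := `[- M, M]%classic.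
pose g (p : R * R) : H := p.1%:C *: u + p.2%:C *: ('i%C *: u).
apply: (@precompact_subset _ _ (g @` (I `*` I))); last first.
  apply: compact_precompact; first exact: norm_hausdorff.
  apply: continuous_compact; last by apply: compact_setX; exact: segment_compact.
  apply: continuous_subspaceT => p; apply: cvgD; apply: cvgZr_tmp.
    apply: (@cvg_comp _ _ _ fst (fun a : R => a%:C : R[i]^o) _ (nbhs p.1)).
      exact: cvg_fst.
    exact: continuous_real_complex.
  apply: (@cvg_comp _ _ _ snd (fun a : R => a%:C : R[i]^o) _ (nbhs p.2)).
    exact: cvg_snd.
  exact: continuous_real_complex.
move=> _ [x x1 <-]; rewrite rank1E; set z := '[x, v].
have zM : `|z| <= M%:C.
  rewrite RRe_real ?normr_real// (le_trans (CauchySchwarz_inner _ _))//.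
  by rewrite ler_piMl.
exists (complex.Re z, complex.Im z); last first.
  by rewrite /g/= scalerA -scalerDl mulrC -complexE.
split; rewrite /I/= in_itv/= -ler_norml -lecR; apply: le_trans zM.
  exact: normc_ge_Re.
have := normc_ge_Re (z * 'i%C).
rewrite ReiNIm normrN normrM (normc_def 'i) /=.
by rewrite expr0n add0r expr1n sqrtr1 mulr1.
Qed.

End RankOne.

(** * Finite orthonormal sequences and their projections *)

Section OrthonormalFamilies.
Variables (R : realType) (H : hilbertType R).
Implicit Types (u v x y : H) (s t : seq H).

Local Notation "''[' x , y ]" := (@inner R H x y).

Definition orthonormal_seq t :=
  pairwise (fun u v => '[u, v] == 0) t && all (fun u => `|u| == 1) t.

(** When [t] is orthonormal this is the projection onto the span of [t], and
    membership of [x] in that span is expressed as [orthoproj t x = x]. *)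
Definition orthoproj t : bounded_op H H := \sum_(u <- t) rank1 u u.

Lemma orthoproj_cons u t x : orthoproj (u :: t) x = '[x, u] *: u + orthoproj t x.
Proof. by rewrite /orthoproj big_cons. Qed.

Lemma orthoproj_nil x : orthoproj [::] x = 0.
Proof. by rewrite /orthoproj big_nil. Qed.

Lemma orthoprojE t x : orthoproj t x = \sum_(u <- t) '[x, u] *: u.
Proof.
elim: t => [|u t IH]; first by rewrite orthoproj_nil big_nil.
by rewrite orthoproj_cons big_cons IH.
Qed.

Lemma orthoproj_adj t x y : '[orthoproj t x, y] = '[x, orthoproj t y].
Proof.
elim: t => [|u t IH]; first by rewrite !orthoproj_nil inner0l inner0r.
by rewrite !orthoproj_cons innerDl innerDr IH innerZl innerZr -innerC mulrC.
Qed.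

Lemma orthoproj_orthogonal t u :
  all (fun v => '[u, v] == 0) t -> orthoproj t u = 0.
Proof.
move=> /allP tu; rewrite orthoprojE big1_seq// => v /andP[_ /tu/eqP->].
by rewrite scale0r.
Qed.

Lemma orthoproj_fix t u : orthonormal_seq t -> u \in t -> orthoproj t u = u.
Proof.
elim: t => // v t IH /andP[/= /andP[tv pt] /andP[/eqP v1 at1]].
have ot : orthonormal_seq t by rewrite /orthonormal_seq pt.
rewrite inE orthoproj_cons => /orP[/eqP ->|ut].
  by rewrite orthoproj_orthogonal// addr0 inner_norm v1 expr1n scale1r.
rewrite -[in '[_, _]](IH ot ut) orthoproj_adj orthoproj_orthogonal//.
by rewrite inner0r scale0r add0r IH.
Qed.

Lemma orthonormal_cons u t : orthonormal_seq (u :: t) =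
  [&& `|u| == 1, orthoproj t u == 0 & orthonormal_seq t].
Proof.
apply/idP/idP => [/andP[/= /andP[tu pt] /andP[-> at1]]|].
  by rewrite orthoproj_orthogonal// eqxx /orthonormal_seq pt.
move=> /and3P[u1 /eqP tu ot]; have /andP[pt at1] := ot.
rewrite /orthonormal_seq/= u1 pt at1 !andbT; apply/allP => v vt.
by rewrite -[v](orthoproj_fix ot vt) -orthoproj_adj tu inner0l.
Qed.

Lemma orthoproj_idem t x :
  orthonormal_seq t -> orthoproj t (orthoproj t x) = orthoproj t x.
Proof.
move=> ot; rewrite [in RHS]orthoprojE [X in orthoproj t X]orthoprojE linear_sum/=.
by apply: eq_big_seq => u ut; rewrite linearZ/= orthoproj_fix.
Qed.

(** [orthoproj t] is self-adjoint and idempotent, so the square norm of the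
    image of [x] is the inner product of that image with [x]. *)
Lemma orthoproj_contract t x : orthonormal_seq t -> `|orthoproj t x| <= `|x|.
Proof.
move=> ot; have [->|p0] := eqVneq (orthoproj t x) 0; first by rewrite normr0.
rewrite -(@ler_pM2r _ `|orthoproj t x|) ?normr_gt0// -expr2 -inner_norm.
rewrite orthoproj_adj orthoproj_idem// -[leLHS]ger0_norm.
  exact: CauchySchwarz_inner.
by rewrite -(orthoproj_idem _ ot) -orthoproj_adj inner_norm exprn_ge0.
Qed.

Lemma orthoproj_le1 t : orthonormal_seq t -> `|orthoproj t| <= 1.
Proof.
by move=> ot; apply: op_norm_le => // x; rewrite mul1r orthoproj_contract.
Qed.

(** An additive function taking the same value at all rank one projections is a
    multiple of the rank on finite rank projections. *)
Lemma additive_orthoproj (f : bounded_op H H -> R[i]) t (l : R[i]) :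
  {morph f : h h' / h + h'} -> (forall u, `|u| = 1 -> f (rank1 u u) = l) ->
  orthonormal_seq t -> f (orthoproj t) = l *+ size t.
Proof.
move=> fD fl; have f0 : f 0 = 0 by apply: (addrI (f 0)); rewrite -fD !addr0.
move=> /andP[_ /allP t1]; rewrite (big_morph f fD f0).
rewrite (eq_big_seq (fun=> l)) => [|u /t1/eqP /fl//].
by rewrite big_const_seq count_predT iter_addr_0.
Qed.

(** One Gram-Schmidt step: normalise the component of [x] orthogonal to [t]. *)
Lemma orthonormal_extend t x : orthonormal_seq t -> orthoproj t x != x ->
  exists2 w, orthonormal_seq (w :: t) & orthoproj (w :: t) x = x.
Proof.
move=> ot tx; pose d := x - orthoproj t x; pose w := `|d|^-1 *: d.
have d0 : `|d| != 0 by rewrite normr_eq0 subr_eq0 eq_sym.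
have td : orthoproj t d = 0 by rewrite linearB/= orthoproj_idem// subrr.
have cd : Num.conj `|d|^-1 = `|d|^-1 by apply/CrealP; rewrite realV normr_real.
have tw : orthoproj t w = 0 by rewrite linearZ/= td scaler0.
exists w.
  rewrite orthonormal_cons ot tw eqxx/= andbT.
  by rewrite normrZ normfV normr_id mulVf.
rewrite orthoproj_cons -[X in '[X, _]](subrK (orthoproj t x)) innerDl.
rewrite orthoproj_adj tw inner0r addr0 -/d innerZr cd inner_norm scalerA.
by rewrite expr2 mulrA mulVf// mul1r mulfV// scale1r subrK.
Qed.

Lemma orthoproj_fix_cons w t y : orthonormal_seq (w :: t) -> orthoproj t y = y ->
  orthoproj (w :: t) y = y.
Proof.
rewrite orthonormal_cons => /and3P[_ /eqP tw _] ty.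
rewrite orthoproj_cons ty -[X in '[X, _]]ty orthoproj_adj tw.
by rewrite inner0r scale0r add0r.
Qed.

Lemma orthonormal_span s :
  exists2 t, orthonormal_seq t & {in s, forall x, orthoproj t x = x}.
Proof.
elim: s => [|x s [t ot ts]]; first by exists [::].
have [tx|tx] := eqVneq (orthoproj t x) x.
  by exists t => // y; rewrite inE => /orP[/eqP ->|/ts].
have [w owt wx] := orthonormal_extend ot tx.
exists (w :: t) => // y; rewrite inE => /orP[/eqP ->//|/ts].
exact: orthoproj_fix_cons.
Qed.

(** An orthonormal sequence that cannot be extended would span [H]. *)
Lemma orthonormal_size n : ~ finite_dimensional H ->
  exists2 t, orthonormal_seq t & size t = n.
Proof.
move=> infH; elim: n => [|n [t ot tn]]; first by exists [::].
have [x tx] : exists x, orthoproj t x != x.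
  apply/not_existsP => tx; apply: infH.
  exists (size t), (fun i : (ordinal (size t)) => t`_i) => x.
  exists (fun i => '[x, t`_i]).
  have /negP/negPn/eqP tx' := tx x.
  by rewrite -[LHS]tx' orthoprojE (big_nth 0) big_mkord.
have [w owt _] := orthonormal_extend ot tx.
by exists (w :: t) => //=; rewrite tn.
Qed.

(** Orthonormal sequences directed by the inclusion of their spans: a property
    holds eventually when it holds as soon as the span of [t] contains some
    finite set of vectors. Along this filter [orthoproj t] converges strongly to
    the identity. *)
Definition orthonormal_net : set_system (seq H) :=
  filter_from setT (fun s =>
    [set t | orthonormal_seq t /\ {in s, forall x, orthoproj t x = x}]).

Global Instance orthonormal_net_filter : ProperFilter orthonormal_net.
Proof.
apply: filter_from_proper; last first.
  by move=> s _; have [t ot ts] := orthonormal_span s; exists t.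
apply: filter_from_filter; first by exists [::].
move=> s s' _ _; exists (s ++ s') => // t [ot tss']; split; split=> // x xs.
  by apply: tss'; rewrite mem_cat xs.
by apply: tss'; rewrite mem_cat xs orbT.
Qed.

Lemma net_fix s :
  \forall t \near orthonormal_net,
    orthonormal_seq t /\ {in s, forall x, orthoproj t x = x}.
Proof. by exists s. Qed.

(** Strong convergence of the contractions [orthoproj t] to the identity is
    uniform on compact sets, in particular on the closure of the image of the
    unit ball by [b]; [near_covering] expresses this uniformity. *)
Lemma orthoproj_compl (b : compact_op H) (e : R[i]) : 0 < e ->
  \forall t \near orthonormal_net, `|comp_op (orthoproj t) b - b| <= e.
Proof.
move=> e0; have := compact_opP b => /compact_op_predP; rewrite precompactE.
set K := closure _ => /compact_near_coveringP cK.
have e2 : 0 < e / 2 by rewrite divr_gt0.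
have : \forall t \near orthonormal_net,
    K `<=` [set y | orthonormal_seq t /\ `|orthoproj t y - y| <= e].
  pose P t y := orthonormal_seq t /\ `|orthoproj t y - y| <= e.
  apply: (cK _ _ P) => x _.
  exists (ball x (e / 2), [set t | orthonormal_seq t /\
      {in [:: x], forall x, orthoproj t x = x}]).
    by split; [exact: nbhsx_ballx|exact: net_fix].
  case=> y t /= [xy [ot tx]]; split=> //.
  have -> : orthoproj t y - y = orthoproj t (y - x) + (x - y).
    by rewrite linearB/= (tx x (mem_head _ _)) addrA subrK.
  move: xy; rewrite -ball_normE/= => xy.
  rewrite (splitr e) (le_trans (ler_normD _ _))// lerD//; last exact: ltW.
  by rewrite (le_trans (orthoproj_contract _ ot))// distrC ltW.
apply: filterS => t Kt.
apply: opnorm_le1 => [|x x1]; first exact: ltW.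
by have [] : [set y | orthonormal_seq t /\ `|orthoproj t y - y| <= e] (b x)
  by apply: Kt; apply: subset_closure; exists x.
Qed.

(** If [orthoproj t1] almost fixes the image of the unit ball by [b], then [b] is
    close in norm to the finite rank operator [comp_op (orthoproj t1) b], and
    composing the latter on the right with [orthoproj t] changes nothing once the
    span of [t] contains the vectors [adjoint b u] for [u \in t1]. *)
Lemma orthoproj_compr (b : compact_op H) (e : R[i]) : 0 < e ->
  \forall t \near orthonormal_net, `|comp_op b (orthoproj t) - b| <= e.
Proof.
move=> e0; have e2 : 0 < e / 2 by rewrite divr_gt0.
have [t1 [[ot1 _] t1b]] :=
  filter_ex (filterI (net_fix [::]) (orthoproj_compl b e2)).
near=> t.
have [ot tb] : orthonormal_seq t /\
    {in map (adjoint b) t1, forall x, orthoproj t x = x}.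
  by near: t; exact: net_fix.
have t1bt x : orthoproj t1 (b (orthoproj t x)) = orthoproj t1 (b x).
  rewrite !(orthoprojE t1); apply: eq_big_seq => u ut1.
  by rewrite !(adjointP b) orthoproj_adj tb// map_f.
apply: op_norm_le => [|x]; first exact: ltW.
rewrite bounded_opBE comp_opE.
have -> : b (orthoproj t x) - b x =
    (comp_op (orthoproj t1) b - b) x
    - (comp_op (orthoproj t1) b - b) (orthoproj t x).
  rewrite !bounded_opBE !comp_opE t1bt opprB.
  by rewrite [RHS]addrC addrA subrK.
rewrite (splitr e) mulrDl (le_trans (ler_normB _ _))// lerD//.
  by rewrite (le_trans (le_op_norm _ _))// ler_wpM2r.
by rewrite (le_trans (le_op_norm _ _))// ler_pM// orthoproj_contract.
Unshelve. all: by end_near. Qed.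

End OrthonormalFamilies.

(** * The derivation attached to a vector functional *)

Section VectorStateDerivation.
Variables (R : realType) (H : hilbertType R) (e : H).
Implicit Types (x y a b c : compact_op H).

Local Notation "''[' x , y ]" := (@inner R H x y).

(** This is ['i * w (x' y - y x')], where [x'] is the adjoint of [x] and
    [w h = '[h e, e]] is the vector functional of [e]. *)
Definition state_bracket x y : R[i] :=
  'i%R * ('[y e, x e] - '[adjoint x e, adjoint y e]).

Lemma state_bracket_le x y :
  `|state_bracket x y| <= 2 * `|e| ^+ 2 * `|x| * `|y|.
Proof.
have bnd (f g : bounded_op H H) : `|'[f e, g e]| <= `|f| * `|g| * `|e| ^+ 2.
  rewrite (le_trans (CauchySchwarz_inner _ _))// expr2 mulrACA.
  by apply: ler_pM => //; exact: le_op_norm.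
rewrite normrM normCi mul1r (le_trans (ler_normB _ _))//.
have -> : 2 * `|e| ^+ 2 * `|x| * `|y| =
    `|y| * `|x| * `|e| ^+ 2 + `|x| * `|y| * `|e| ^+ 2 by ring.
apply: lerD; first exact: bnd.
rewrite (le_trans (bnd _ _))// ler_wpM2r ?exprn_ge0//.
by apply: ler_pM => //; exact: adjoint_norm_le.
Qed.

Lemma state_bracket_linear x : linear (state_bracket x : _ -> R[i]^o).
Proof.
move=> k y z; rewrite /state_bracket.
have -> : adjoint (k *: y + z : compact_op H) =
    Num.conj k *: adjoint y + adjoint z by exact: adjointP_lin.
have -> : (k *: y + z : compact_op H) e = k *: y e + z e by [].
rewrite bounded_opDE bounded_opZE innerDl innerDr innerZl innerZr conjCK.
by rewrite -[k *: _]/(k * _); ring.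
Qed.

Lemma state_bracket_subproof x :
  (state_bracket x : _ -> R[i]^o) \in @bounded_op_pred R (compact_op H) R[i]^o.
Proof.
exact: (@bounded_opP_bound _ _ _ _ (2 * `|e| ^+ 2 * `|x|)
  (state_bracket_linear x) (state_bracket_le x)).
Qed.

Definition state_derivation x : topdual (compact_op H) :=
  BoundedOp (state_bracket_subproof x).

Lemma state_derivation_linear :
  linear_for (@Num.conj R[i] \; *:%R) state_derivation.
Proof.
move=> k x z; apply: bounded_op_ext => y.
rewrite -[RHS]/(Num.conj k * state_bracket x y + state_bracket z y).
rewrite -[LHS]/(state_bracket (k *: x + z) y) /state_bracket.
have -> : adjoint (k *: x + z : compact_op H) =
    Num.conj k *: adjoint x + adjoint z by exact: adjointP_lin.
have -> : (k *: x + z : compact_op H) e = k *: x e + z e by [].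
by rewrite bounded_opDE bounded_opZE !innerDl !innerDr innerZl innerZr; ring.
Qed.

Lemma state_derivation_continuous : continuous state_derivation.
Proof.
move=> x; apply/(@cvgrPdist_lt _ _ _ (nbhs x)) => r r0.
pose M := 2 * `|e| ^+ 2 + 1.
have M0 : 0 < M by rewrite ltr_wpDl// mulr_ge0// exprn_ge0.
have zx : \forall z \near nbhs x, ball x (r / M) z.
  by apply: nbhsx_ballx; rewrite divr_gt0.
apply: filterS zx => z; rewrite -ball_normE/= => zx.
have -> : state_derivation x - state_derivation z = state_derivation (x - z).
  have := state_derivation_linear (-1) z x.
  rewrite scaleN1r [- z + x]addrC => ->.
  by rewrite /= rmorphN rmorph1 scaleN1r [RHS]addrC.
apply: (@le_lt_trans _ _ (M * `|x - z|)); last by rewrite mulrC -ltr_pdivlMr.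
apply: op_norm_le => [|y]; first by rewrite mulr_ge0// ltW.
apply: le_trans (state_bracket_le _ _) _.
by rewrite ler_wpM2r// ler_wpM2r// lerDl.
Qed.

Lemma adjoint_tprod a b c z : adjoint (tprod a b c : compact_op H) z =
  2^-1 *: (adjoint c (b (adjoint a z)) + adjoint a (b (adjoint c z))).
Proof.
have c2 : Num.conj (2^-1 : R[i]) = 2^-1 by apply/CrealP; rewrite realV realn.
apply: inner_ext => w; rewrite -adjointP compact_tprodE innerZl innerZr c2.
by rewrite innerDl innerDr !adjointP adjointK.
Qed.

(** Both sides, evaluated at an operator, are combinations of terms
    ['[W e, e]] with [W] a word in [a], [b], [c], the argument and their
    adjoints. Moving every operator to the left of the inner product makes equal
    words syntactically equal. *)
Lemma state_derivationP : ternary_derivation state_derivation.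
Proof.
split=> [|a b c]; first exact: state_derivation_linear.
apply: bounded_op_ext => y; rewrite !bounded_opDE.
rewrite -[LHS]/(state_bracket (tprod a b c) y).
rewrite -[dual_outer c b _ y]/(state_bracket a (tprod b c y)).
rewrite -[dual_middle a _ c y]/(Num.conj (state_bracket b (tprod a y c))).
rewrite -[dual_outer a b _ y]/(state_bracket c (tprod b a y)).
have tE f g h z : (tprod f g h : compact_op H) z =
  2^-1 *: (f (adjoint g (h z)) + h (adjoint g (f z))) by [].
have c2 : Num.conj (2^-1 : R[i]) = 2^-1 by apply/CrealP; rewrite realV realn.
rewrite /state_bracket !adjoint_tprod !tE !innerZl !innerZr !c2.
rewrite !innerDl !innerDr !adjointPr !adjointK.
rewrite !(rmorphM, rmorphB, rmorphD)/= c2 conjCi -!innerC !adjointPr !adjointK.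
by ring.
Qed.

End VectorStateDerivation.

(** * Functionals attached to an inner derivation *)

(** The values of a functional lie in [R[i]] seen as a module over itself; the
    next lemmas restate linearity with the ring operations of [R[i]]. *)
Lemma topdualD (R : realType) (E : jordanBanachTripleType R)
    (phi : topdual E) (x y : E) : phi (x + y) = phi x + phi y :> R[i].
Proof. exact: (linearD phi). Qed.

Lemma topdualB (R : realType) (E : jordanBanachTripleType R)
    (phi : topdual E) (x y : E) : phi (x - y) = phi x - phi y :> R[i].
Proof. exact: (linearB phi). Qed.

Lemma topdualZ (R : realType) (E : jordanBanachTripleType R)
    (phi : topdual E) k (x : E) : phi (k *: x) = k * phi x :> R[i].
Proof. exact: (linearZ_LR phi). Qed.

Lemma topdual_sum (R : realType) (E : jordanBanachTripleType R) (I : Type)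
    (r : seq I) (F : I -> topdual E) (x : E) :
  (\sum_(i <- r) F i) x = \sum_(i <- r) (F i x : R[i]) :> R[i].
Proof. by elim: r => [|i r IH]; rewrite ?big_nil// !big_cons bounded_opDE IH. Qed.

Section InnerFunctionals.
Variables (R : realType) (H : hilbertType R) (e : H).
Variable s : seq (compact_op H * topdual (compact_op H)).
Implicit Types (u v : H) (h : bounded_op H H) (b : compact_op H) (t : seq H).

Local Notation "''[' x , y ]" := (@inner R H x y).

Definition mulr_op b h : compact_op H :=
  CompactOp (compact_comp_opr h (compact_opP b)).
Definition mull_op h b : compact_op H :=
  CompactOp (compact_comp_opl h (compact_opP b)).

(** If [p.2] is the trace against a trace class operator [c_p], then this is the
    trace against the sum of the [c_p p.1], and [right_functional] is the trace
    against the sum of the [p.1 c_p]. These two sums have the same trace. *)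
Definition left_functional h : R[i] := \sum_(p <- s) p.2 (mulr_op p.1 h).
Definition right_functional h : R[i] := \sum_(p <- s) p.2 (mull_op h p.1).

Lemma left_functionalD h h' :
  left_functional (h + h') = left_functional h + left_functional h'.
Proof.
rewrite -big_split/=; apply: eq_bigr => p _; rewrite -topdualD; congr (p.2 _).
by apply: compact_op_ext => x; exact: (linearD p.1).
Qed.

Lemma right_functionalD h h' :
  right_functional (h + h') = right_functional h + right_functional h'.
Proof.
rewrite -big_split/=; apply: eq_bigr => p _; rewrite -topdualD; congr (p.2 _).
exact: compact_op_ext.
Qed.

Lemma left_functional_le h :
  `|left_functional h| <= (\sum_(p <- s) `|p.2| * `|p.1|) * `|h|.
Proof.
rewrite mulr_suml (le_trans (ler_norm_sum _ _ _))//; apply: ler_sum => p _.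
apply: le_trans (le_op_norm p.2 _) _; rewrite -mulrA ler_wpM2l//.
exact: comp_op_normM.
Qed.

(** An inner derivation evaluated at [x], [x] is half the sum of [conj A - A] at
    [x' x] and [conj B - B] at [x x'], where [x'] is the adjoint of [x] and [A],
    [B] are the left and right functionals; [state_derivation e] has the same
    shape, with [2 'i w] and [- 2 'i w] in place of [conj A - A] and
    [conj B - B], where [w h = '[h e, e]]. The defects are the differences. *)
Definition defect_left h : R[i] :=
  Num.conj (left_functional h) - left_functional h - 'i%R * 2 * '[h e, e].
Definition defect_right h : R[i] :=
  Num.conj (right_functional h) - right_functional h + 'i%R * 2 * '[h e, e].

Lemma defect_leftD : {morph defect_left : h h' / h + h'}.
Proof.
move=> h h'; rewrite /defect_left left_functionalD rmorphD bounded_opDE innerDl.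
by ring.
Qed.

Lemma defect_rightD : {morph defect_right : h h' / h + h'}.
Proof.
move=> h h'; rewrite /defect_right right_functionalD rmorphD bounded_opDE innerDl.
by ring.
Qed.

Hypothesis deltaE : forall x, state_derivation e x =
  \sum_(p <- s) inner_derivation_at p.1 p.2 x.

(** Evaluate the equality of derivations at [x = rank1 u v], for which [x]
    is a partial isometry with initial and final projections [rank1 v v] and
    [rank1 u u]. The two vectors are independent of each other, so either defect
    is constant on rank one projections. *)
Lemma defect_rank1 u v : `|u| = 1 -> `|v| = 1 ->
  defect_left (rank1 v v) + defect_right (rank1 u u) = 0.
Proof.
move=> u1 v1; pose x : compact_op H := CompactOp (rank1_compact u v).
have xE z : x z = '[z, v] *: u by [].
have axE z : adjoint x z = '[z, u] *: v by rewrite adjoint_rank1.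
have uu : '[u, u] = 1 by rewrite inner_norm u1 expr1n.
have vv : '[v, v] = 1 by rewrite inner_norm v1 expr1n.
have bxx b : tprod b x x =
    2^-1 *: (mulr_op b (rank1 v v) + mull_op (rank1 u u) b).
  apply: compact_op_ext => z.
  rewrite -[LHS]/(2^-1 *: (b (adjoint x (x z)) + x (adjoint x (b z)))).
  by rewrite !(xE, axE) !innerZl uu vv !mulr1.
have c2 : Num.conj (2^-1 : R[i]) = 2^-1 by apply/CrealP; rewrite realV realn.
have innerE p : 2 * (inner_derivation_at p.1 p.2 x x : R[i]) =
    Num.conj (p.2 (mulr_op p.1 (rank1 v v))) - p.2 (mulr_op p.1 (rank1 v v)) +
    (Num.conj (p.2 (mull_op (rank1 u u) p.1)) - p.2 (mull_op (rank1 u u) p.1)).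
  rewrite -[inner_derivation_at p.1 p.2 x x]/
    (Num.conj (p.2 (tprod p.1 x x)) - p.2 (tprod p.1 x x)) bxx topdualZ topdualD.
  by rewrite rmorphM rmorphD/= c2 -mulrBr mulrA divff ?pnatr_eq0// mul1r; ring.
have : 2 * ('i%R * ('[e, v] * '[v, e] - '[e, u] * '[u, e])) =
  Num.conj (left_functional (rank1 v v)) - left_functional (rank1 v v)
  + (Num.conj (right_functional (rank1 u u)) - right_functional (rank1 u u)).
  rewrite /left_functional /right_functional !rmorph_sum -!sumrB -big_split/=.
  under eq_bigr do rewrite -innerE.
  rewrite -mulr_sumr -topdual_sum -deltaE.
  rewrite -[state_derivation _ _ _]/(state_bracket e x x) /state_bracket.
  by rewrite !(xE, axE) !innerZl !innerZr uu vv !mulr1 -!innerC.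
rewrite /defect_left /defect_right !rank1E !innerZl => /eqP.
rewrite -subr_eq0 => /eqP hE.
by apply: (etrans _ (etrans (congr1 -%R hE) (oppr0 _))); ring.
Qed.

End InnerFunctionals.

Lemma orthoproj_commute_net (R : realType) (H : hilbertType R)
    (s : seq (compact_op H * topdual (compact_op H))) (r : R[i]) : 0 < r ->
  \forall t \near @orthonormal_net R H, forall p, p \in s ->
    `|comp_op p.1 (orthoproj t) - comp_op (orthoproj t) p.1| <= r.
Proof.
move=> r0; have r2 : 0 < r / 2 by rewrite divr_gt0.
elim: s => [|q s IH]; first by apply: nearW => t p; rewrite in_nil.
have ql := orthoproj_compl q.1 r2; have qr := orthoproj_compr q.1 r2.
apply: filterS (filterI IH (filterI ql qr)) => t [ts [tl tr]] p.
rewrite inE => /orP[/eqP ->|]; last exact: ts.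
rewrite (splitr r) (le_trans (ler_distD (q.1 : bounded_op H H) _ _))// lerD//.
by rewrite distrC.
Qed.

(** The substitute for the trace identity [tr (b c) = tr (c b)]: the difference
    evaluated at [orthoproj t] is the sum of the [p.2] at the commutators of [p.1]
    with [orthoproj t], which tend to [0] in norm because [p.1] is compact. *)
Lemma functionals_close (R : realType) (H : hilbertType R)
    (s : seq (compact_op H * topdual (compact_op H))) (r : R[i]) : 0 < r ->
  \forall t \near @orthonormal_net R H,
    `|left_functional s (orthoproj t) - right_functional s (orthoproj t)| <= r.
Proof.
move=> r0; pose N := \sum_(p <- s) `|p.2|.
have N0 : 0 <= N by apply: sumr_ge0.
have N1 : 0 < N + 1 by rewrite ltr_wpDl.
apply: filterS (orthoproj_commute_net s (divr_gt0 r0 N1)) => t ts.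
rewrite -sumrB (le_trans (ler_norm_sum _ _ _))//.
apply: (@le_trans _ _ (N * (r / (N + 1)))); last first.
  rewrite mulrCA ler_piMr ?(ltW r0)//.
  by rewrite ler_pdivrMr// mul1r lerDl.
rewrite mulr_suml big_seq [leRHS]big_seq; apply: ler_sum => p ps.
rewrite -topdualB; apply: le_trans (le_op_norm p.2 _) _.
by rewrite ler_wpM2l//; exact: ts.
Qed.

(** * Contradiction with innerness *)

(** The order of [R[i]] is only partial, so the Archimedean property is applied
    to real parts. *)
Lemma mulrn_bounded_eq0 (R : realType) (l M : R[i]) :
  (forall n : nat, `|l *+ n| <= M) -> l = 0.
Proof.
move=> lM; apply/normr0_eq0/eqP; rewrite -[_ == _]negbK; apply/negP => l0.
have cN (z : R[i]) : 0 <= z -> (complex.Re z)%:C = z.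
  by move=> z0; rewrite RRe_real// ger0_real.
have M0 : 0 <= M by apply: le_trans (lM 0%N).
have rl : 0 < complex.Re `|l|.
  by rewrite -ltcR cN// lt_def l0 normr_ge0.
have rM : 0 <= complex.Re M by rewrite -ler0c cN.
have := archi_boundP (divr_ge0 rM (ltW rl)).
set n := Num.bound _; rewrite ltr_pdivrMr// => nM.
have := lM n; rewrite normrMn -(cN `|l|)// -(cN M)// -rmorphMn/= lecR -mulr_natl.
by rewrite leNgt nM.
Qed.

Theorem proposition4p2 (R : realType) (H : hilbertType R) :
  ~ finite_dimensional H -> ~ ternary_weakly_amenable (compact_op H).
Proof.
move=> infH wamen.
have [[|e t0] // oe _] := orthonormal_size 1 infH.
have {oe} e1 : `|e| = 1 by move: oe; rewrite orthonormal_cons => /and3P[/eqP].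
have [s sE] := wamen _ (@state_derivation_continuous _ _ e) (state_derivationP e).
pose l := defect_left e s (rank1 e e).
have lE u : `|u| = 1 -> defect_left e s (rank1 u u) = l.
  move=> u1; apply: (addIr (defect_right e s (rank1 e e))).
  by rewrite /l !(defect_rank1 sE).
have rE u : `|u| = 1 -> defect_right e s (rank1 u u) = - l.
  by move=> u1; apply: (addrI l); rewrite subrr /l (defect_rank1 sE).
(* The functionals in [defect_left] are bounded and [orthoproj t] is a
   contraction, so the multiples of [l] by the ranks are bounded; ranks are
   unbounded since [H] is infinite dimensional. *)
have l0 : l = 0.
  pose M := \sum_(p <- s) `|p.2| * `|p.1|.
  apply: (@mulrn_bounded_eq0 _ _ (M + M + 2)) => n.
  have [t ot <-] := orthonormal_size n infH.
  rewrite -(additive_orthoproj (@defect_leftD _ _ e s) lE ot).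
  have pM : `|left_functional s (orthoproj t)| <= M.
    rewrite (le_trans (left_functional_le _ _))// ler_piMr ?orthoproj_le1//.
    by apply: sumr_ge0 => p _; rewrite mulr_ge0.
  rewrite (le_trans (ler_normB _ _))// lerD//.
    by rewrite (le_trans (ler_normB _ _))// norm_conjC lerD.
  rewrite !normrM normCi mul1r normr_nat ler_piMr//.
  rewrite (le_trans (CauchySchwarz_inner _ _))// e1 mulr1.
  by rewrite -e1 orthoproj_contract.
(* With vanishing defects, and [e] in the span of [t], the left and right
   functionals [A] and [B] satisfy [conj (A - B) - (A - B) = 4 'i], although
   [A - B] can be made as small as desired. *)
have [t [tc [ot te]]] := filter_ex (filterI (functionals_close s ltr01)
  (net_fix [:: e])).
have := additive_orthoproj (@defect_leftD _ _ e s) lE ot.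
have := additive_orthoproj (@defect_rightD _ _ e s) rE ot.
rewrite l0 oppr0 mul0rn /defect_left /defect_right te ?mem_head//.
rewrite inner_norm e1 expr1n mulr1.
set A := left_functional _ _ in tc *; set B := right_functional _ _ in tc *.
move=> B0 A0.
have AB : 'i%R * 4 = Num.conj (A - B) - (A - B).
  have -> : Num.conj (A - B) - (A - B) =
    (Num.conj A - A - 'i%R * 2) - (Num.conj B - B + 'i%R * 2) + 'i%R * 4.
    by rewrite rmorphB; ring.
  by rewrite A0 B0 subrr add0r.
have : `|'i%R * 4 : R[i]| <= 1 + 1.
  by rewrite AB (le_trans (ler_normB _ _))// norm_conjC lerD.
rewrite normrM normCi mul1r normr_nat -[1 + 1]/(2%:R) ler_nat.
by [].
Qed.
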